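(* Suppose subsidies and repair costs are at most $H$. For any $\epsilon,\delta>0$ and any distribution $\mathcal{D}$ over component maintenance games with $n$ agents, $O\!\left(\frac{n^2H^2}{\epsilon^2}\left(n^2+\log\frac1\delta\right)\right)$ games drawn i.i.d. from $\mathcal{D}$ suffice to ensure that, with probability at least $1-\delta$ over the draw, the subsidy vector $\hat\sigma\in[0,H]^n$ minimizing the average of $\tilde L_{\mathrm{prior}}$ over the sample has expected loss $\mathbb{E}_{G\sim\mathcal{D}}[\tilde L^G_{\mathrm{prior}}(\hat\sigma)]$ at most $\epsilon$ larger than $\min_{\sigma\in[0,H]^n}\mathbb{E}_{G\sim\mathcal{D}}[\tilde L^G_{\mathrm{prior}}(\sigma)]$.
   Context: Component maintenance game with $n$ agents: agent $i$ owns component $i$ with random state $x_i\in\{0,1\}$ under a common prior $\theta$ (independent components), Boolean system function $\phi$, repair costs $C_i\le H$. Agent $i$ chooses $s_i\in\{0,1\}$ (1 = repair); post-action state $x_i'=\max\{x_i,s_i\}$; expected cost $l_i(s)=C_is_i+1-\mathbb{E}_\theta[\phi(\bm{x}'(s))]$. A subsidy scheme is a vector $\sigma\in[0,H]^n$: agent $i$ receives $\mathrm{subs}_i(s)=\sigma_is_i$, subsidized cost $l_i(s)-\mathrm{subs}_i(s)$, $\mathrm{cost}^\sigma(s)=\sum_i(l_i(s)-\mathrm{subs}_i(s))$, $\mathrm{subs}(s)=\sum_i\mathrm{subs}_i(s)$. With $\mathcal{S}_{NE}(\sigma)$ the (nonempty) set of pure Nash equilibria of the subsidized game, the average-case loss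 is $\tilde L^G_{\mathrm{prior}}(\sigma)=\frac{1}{|\mathcal{S}_{NE}(\sigma)|}\sum_{s\in\mathcal{S}_{NE}(\sigma)}\left(\mathrm{cost}^\sigma(s)+\mathrm{subs}(s)\right)$.
   Formalization: The formal statement assumes H ≥ 1 (and repair costs nonnegative): the failure cost is normalized to 1, so loss differences stay of order n as H tends to 0 and the stated sample bound with a uniform constant fails for small H. *)

(* Defs.v *)
From HB Require Import structures.
From mathcomp Require Import all_boot all_order all_algebra.
From mathcomp Require Import all_classical all_reals all_analysis.
Set Implicit Arguments. Unset Strict Implicit. Unset Printing Implicit Defensive.
Import Order.TTheory GRing.Theory Num.Theory.
Local Open Scope classical_set_scope.
Local Open Scope ring_scope.

Notation profile n := {ffun 'I_n -> bool}.

(* A component maintenance game: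
   - [cm_prior i] = theta_i = Pr[x_i = 1]; the prior is the product
     (independent components) distribution with these marginals;
   - [cm_phi] : {0,1}^n -> {0,1} is the Boolean system function;
   - [cm_cost i] = C_i, the repair cost of agent i. *)
Record cmgame (R : realType) (n : nat) := CMGame {
  cm_prior : 'I_n -> R;
  cm_phi : {ffun profile n -> bool};
  cm_cost : 'I_n -> R }.

Section Game.
Variables (R : realType) (n : nat) (G : cmgame R n).

Definition prior_prob (x : profile n) : R :=
  \prod_(i < n) (if x i then cm_prior G i else 1 - cm_prior G i).

Definition post_state (x s : profile n) : profile n := [ffun i => x i || s i].

Definition exp_phi (s : profile n) : R :=
  \sum_(x : profile n) prior_prob x * (cm_phi G (post_state x s))%:R.

Definition cm_loss (i : 'I_n) (s : profile n) : R :=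
  cm_cost G i * (s i)%:R + 1 - exp_phi s.

Definition subs_i (sigma : 'I_n -> R) (i : 'I_n) (s : profile n) : R :=
  sigma i * (s i)%:R.

Definition subs_cost (sigma : 'I_n -> R) (i : 'I_n) (s : profile n) : R :=
  cm_loss i s - subs_i sigma i s.

Definition cost_sigma (sigma : 'I_n -> R) (s : profile n) : R :=
  \sum_(i < n) subs_cost sigma i s.

Definition subs (sigma : 'I_n -> R) (s : profile n) : R :=
  \sum_(i < n) subs_i sigma i s.

Definition deviate (s : profile n) (i : 'I_n) (b : bool) : profile n :=
  [ffun j => if j == i then b else s j].

Definition is_pure_NE (sigma : 'I_n -> R) (s : profile n) : bool :=
  [forall i : 'I_n, forall b : bool,
     subs_cost sigma i s <= subs_cost sigma i (deviate s i b)].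

Definition NE_set (sigma : 'I_n -> R) : {set profile n} :=
  [set s | is_pure_NE sigma s].

Definition avg_loss (sigma : 'I_n -> R) : R :=
  (#|NE_set sigma|%:R)^-1 *
  \sum_(s in NE_set sigma) (cost_sigma sigma s + subs sigma s).

End Game.

Definition in_box (R : realType) (n : nat) (H : R) (sigma : 'I_n -> R) : Prop :=
  forall i, 0 <= sigma i <= H.

(* A distribution over games is given as a probability D on a measurable
   space T together with a map g : T -> games (the distribution of games is
   the pushforward of D by g).  g must be measurable w.r.t. the natural
   (Borel x discrete) structure on the game parameters. *)
Definition measurable_games (R : realType) (n : nat) (d : measure_display)
    (T : measurableType d) (g : T -> cmgame R n) : Prop :=
  [/\ (forall i, measurable_fun setT (fun t => cm_prior (g t) i)),
      (forall i, measurable_fun setT (fun t => cm_cost (g t) i)) &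
      (forall f, measurable [set t | cm_phi (g t) = f])].

Definition valid_games (R : realType) (n : nat) (H : R) (T : Type)
    (g : T -> cmgame R n) : Prop :=
  forall t i, 0 <= cm_prior (g t) i <= 1 /\ 0 <= cm_cost (g t) i <= H.

(* X_0, ..., X_{m-1} : Omega -> T are i.i.d. with law D: measurable, and
   mutually independent with each marginal D (product rule on rectangles). *)
Definition iid_sample (R : realType) (dO dT : measure_display)
    (Omega : measurableType dO) (T : measurableType dT)
    (Q : probability Omega R) (D : probability T R) (m : nat)
    (X : 'I_m -> Omega -> T) : Prop :=
  (forall j, measurable_fun setT (X j)) /\
  forall A : 'I_m -> set T, (forall j, measurable (A j)) ->
    fine (Q [set w | forall j, A j (X j w)]) = \prod_(j < m) fine (D (A j)).

Definition emp_loss (R : realType) (n : nat) (T Omega : Type)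
    (g : T -> cmgame R n) (m : nat) (X : 'I_m -> Omega -> T) (w : Omega)
    (sigma : 'I_n -> R) : R :=
  (m%:R)^-1 * \sum_(j < m) avg_loss (g (X j w)) sigma.

Definition exp_loss (R : realType) (n : nat) (d : measure_display)
    (T : measurableType d) (D : probability T R) (g : T -> cmgame R n)
    (sigma : 'I_n -> R) : \bar R :=
  (\int[D]_t (avg_loss (g t) sigma)%:E)%E.

(* Main.v *)
Require Import Defs.
From HB Require Import structures.
From mathcomp Require Import all_boot all_order all_algebra.
From mathcomp Require Import all_classical all_reals all_analysis.
From mathcomp Require Import measurable_realfun ring lra zify.
Set Implicit Arguments.
Unset Strict Implicit.
Unset Printing Implicit Defensive.
Import Order.TTheory GRing.Theory Num.Theory.
Local Open Scope classical_set_scope.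
Local Open Scope ring_scope.

(** As a function of the subsidies, the loss of a game only depends on how each
    [sigma i] compares with the [2 ^ n] indifference thresholds of agent [i].
    Cutting each axis at the quantiles of the expected number of thresholds
    covers the box by at most [(2 * 4 ^ n * P) ^ n] cells, such that on each cell
    the loss is constant outside an event of probability [1 / P] that depends on
    the cell only.  Chaining along [P = 16 ^ k], with a Bernstein bound for each
    link and for the exceptional events of the last scale [16 ^ k ~ n H / eps],
    controls all subsidies at once.  The variance of a link decays like
    [16 ^ - k]: this absorbs the logarithms of the cover sizes and leaves no
    factor [ln (1 / eps)]. *)

(** * Real-valued probabilities and expectations of finite-valued maps *)

Section ProbabilityBasics.
Variables (R : realType) (d : measure_display) (T : measurableType d).
Variable D : probability T R.

Lemma fine_prob_ge0 (A : set T) : 0 <= fine (D A).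
Proof. exact/fine_ge0/measure_ge0. Qed.

Lemma le_fine_prob (A B : set T) : measurable A -> measurable B ->
  A `<=` B -> fine (D A) <= fine (D B).
Proof.
move=> mA mB AB; apply: fine_le; rewrite ?fin_num_measure//.
by apply: le_measure; rewrite ?inE.
Qed.

Lemma fine_prob_le1 (A : set T) : measurable A -> fine (D A) <= 1.
Proof.
move=> mA; rewrite -lee_fin fineK ?fin_num_measure//; exact: probability_le1.
Qed.

Lemma fine_prob_setC (A : set T) : measurable A ->
  fine (D (~` A)) = 1 - fine (D A).
Proof.
by move=> mA; rewrite probability_setC// fineB// ?fin_num_measure.
Qed.

Lemma fine_prob_union_le (I : finType) (P : pred I) (A : set T)
    (B : I -> set T) : measurable A -> (forall i, measurable (B i)) ->
  (forall t, A t -> exists2 i, P i & B i t) ->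
  fine (D A) <= \sum_(i | P i) fine (D (B i)).
Proof.
move=> mA mB AB.
have mU r : measurable (\big[setU/set0]_(i <- r | P i) B i).
  by apply: bigsetU_measurable.
have le_r r : fine (D (\big[setU/set0]_(i <- r | P i) B i)) <=
    \sum_(i <- r | P i) fine (D (B i)).
  elim: r => [|i r IH]; first by rewrite !big_nil measure0.
  rewrite !big_cons; case: ifP => // Pi.
  apply: le_trans (_ : _ <= fine (D (B i) + D (\big[setU/set0]_(j <- r | P j) B j))) _.
    apply: fine_le; rewrite ?fin_numD ?fin_num_measure//; first exact: measurableU.
    exact: measureU2.
  by rewrite fineD ?fin_num_measure// lerD2l.
apply: le_trans (le_r _); apply: le_fine_prob => // t /AB [i Pi Bit].
by rewrite (bigD1 i)//=; left.
Qed.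

Lemma fine_prob_setCI_le (A B : set T) : measurable A -> measurable B ->
  fine (D (~` (A `&` B))) <= fine (D (~` A)) + fine (D (~` B)).
Proof.
move=> mA mB; have mAC := measurableC mA; have mBC := measurableC mB.
rewrite setCI -fineD ?fin_num_measure//; apply: fine_le.
- by rewrite fin_num_measure//; exact: measurableU.
- by rewrite fin_numD !fin_num_measure.
- exact: measureU2.
Qed.

Lemma bounded_integrable (F : T -> R) (M : R) : measurable_fun setT F ->
  (forall t, `|F t| <= M) -> D.-integrable setT (EFin \o F).
Proof.
move=> mF bF; apply: measurable_bounded_integrable => //.
  by rewrite -ge0_fin_numE ?measure_ge0// fin_num_measure.
by exists M; split; rewrite ?num_real// => x Mx t _; exact: le_trans (bF t) (ltW Mx).
Qed.

(** [phi (Z t)] is a finite combination of indicators of the fibres of [Z]. Asking for measurable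
    fibres lets [V] be a bare finite type, such as the system functions or the sets of profiles,
    with no sigma-algebra chosen on it. *)
Lemma measurable_finite_valued (V : finType) (Z : T -> V) (phi : V -> R) :
  (forall v, measurable (Z @^-1` [set v])) ->
  measurable_fun setT (fun t => phi (Z t)).
Proof.
move=> mZ.
have -> : (fun t => phi (Z t)) = (fun t => \sum_v phi v * \1_(Z @^-1` [set v]) t).
  apply/funext => t; rewrite (bigD1 (Z t))//= indicE mem_set// mulr1.
  rewrite big1 ?addr0// => v vZ.
  by rewrite indicE memNset ?mulr0//= => Ztv; rewrite -Ztv eqxx in vZ.
apply: measurable_sum => v.
exact: (measurable_funM (f := cst (phi v)) (g := \1_(Z @^-1` [set v]))).
Qed.

Lemma Rintegral_indic (A : set T) : measurable A ->
  \int[D]_t \1_A t = fine (D A).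
Proof. by move=> mA; rewrite /Rintegral integral_indic// setIT. Qed.

Lemma indic_norm_le1 (A : set T) (t : T) : `|\1_A t| <= 1 :> R.
Proof. by rewrite indicE; case: (_ \in _); rewrite /= ?normr1 ?normr0. Qed.

Lemma Rintegral_finite_valued (V : finType) (Z : T -> V) (phi : V -> R) :
  (forall v, measurable (Z @^-1` [set v])) ->
  \int[D]_t phi (Z t) = \sum_v phi v * fine (D (Z @^-1` [set v])).
Proof.
move=> mZ; rewrite /Rintegral.
have -> : (\int[D]_t (phi (Z t))%:E =
    \int[D]_t \sum_v (phi v * \1_(Z @^-1` [set v]) t)%:E)%E.
  apply: eq_integral => t _; rewrite sumEFin; congr EFin.
  rewrite (bigD1 (Z t))//= indicE mem_set// mulr1 big1 ?addr0// => v vZ.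
  by rewrite indicE memNset ?mulr0//= => Ztv; rewrite -Ztv eqxx in vZ.
have iZ v : D.-integrable setT
    (fun t => (phi v * \1_(Z @^-1` [set v]) t)%:E).
  apply: (@bounded_integrable (fun t => phi v * \1_(Z @^-1` [set v]) t) `|phi v|).
    by apply: measurable_funM => //; exact: measurable_indic.
  move=> t; rewrite normrM ler_piMr// indicE; case: (_ \in _) => /=.
    by rewrite normr1.
  by rewrite normr0.
rewrite integral_sum//.
have -> : \sum_v (\int[D]_t (phi v * \1_(Z @^-1` [set v]) t)%:E)%E =
    \sum_v (phi v * fine (D (Z @^-1` [set v])))%:E.
  apply: eq_bigr => v _; under eq_integral do rewrite EFinM.
  rewrite integralZl//; last first.
    apply: (@bounded_integrable (\1_(Z @^-1` [set v])) 1).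
      exact: measurable_indic.
    by move=> t; rewrite indicE; case: (_ \in _); rewrite /= ?normr1 ?normr0.
  by rewrite integral_indic// setIT EFinM fineK// fin_num_measure.
by rewrite sumEFin.
Qed.

Lemma sum_fine_prob_preimage (V : finType) (Z : T -> V) :
  (forall v, measurable (Z @^-1` [set v])) ->
  \sum_v fine (D (Z @^-1` [set v])) = 1.
Proof.
move=> mZ; have := Rintegral_finite_valued (fun=> 1) mZ.
rewrite Rintegral_cst// mul1r.
rewrite (_ : fine _ = 1) ?(congr1 fine (probability_setT D))// => ->.
by apply: eq_bigr => v _; rewrite mul1r.
Qed.

End ProbabilityBasics.

(** * Bernstein's inequality for bounded functions of an i.i.d. sample *)

Lemma expR_le_quadratic (R : realType) (x : R) : x <= 2^-1 ->
  expR x <= 1 + x + 2 * x ^+ 2.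
Proof.
move=> x2.
have x1 : 0 < 1 - x by lra.
(* Inverting gives [expR x <= (1 - x)^-1]; then [(1 - x) * (1 + x + 2 * x ^+ 2) = 1 + x ^+ 2 * (1 -
   2 * x)], which is at least 1. *)
have : 1 - x <= (expR x)^-1 by rewrite -expRN; apply: le_trans (expR_ge1Dx _); lra.
rewrite -[X in X <= _]invrK lef_pV2 ?posrE ?expR_gt0 ?invr_gt0// => h.
apply: le_trans h _; rewrite -[X in X <= _]mul1r ler_pdivrMr//.
have : 0 <= x ^+ 2 by exact: sqr_ge0.
nra.
Qed.

Section Concentration.
Variables (R : realType) (dO dT : measure_display).
Variables (Omega : measurableType dO) (T : measurableType dT).
Variables (Q : probability Omega R) (D : probability T R).
Variables (m : nat) (X : 'I_m -> Omega -> T).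
Hypothesis iidX : iid_sample Q D X.

Lemma iid_measurable_sum (F : T -> R) : measurable_fun setT F ->
  measurable_fun setT (fun w => \sum_(j < m) F (X j w)).
Proof.
move=> mF; apply: measurable_sum => j.
exact: (measurableT_comp mF (iidX.1 j)).
Qed.

(* The law of [(Z (X_j))_j] is a product of finite laws, so that the
   exponential moment of the sum factorises without integrating over [Q]. *)
Lemma chernoff_finite_valued (V : finType) (Z : T -> V) (z : V -> R)
    (lam a : R) : (forall v, measurable (Z @^-1` [set v])) -> 0 <= lam ->
  fine (Q [set w | a <= \sum_(j < m) z (Z (X j w))]) <=
  expR (- (lam * a)) *
    (\sum_v fine (D (Z @^-1` [set v])) * expR (lam * z v)) ^+ m.
Proof.
move=> mZ lam0; set q := fun v => fine (D (Z @^-1` [set v])).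
pose W (v : {ffun 'I_m -> V}) : set Omega := [set w | forall j, Z (X j w) = v j].
have mW v : measurable (W v).
  have -> : W v = \bigcap_(j in setT) (X j @^-1` (Z @^-1` [set v j])).
    by apply/seteqP; split => w /= h j; [move=> _; exact: h | exact: (h j I)].
  apply: fin_bigcap_measurable => // j _; rewrite -[X in measurable X]setTI.
  exact: iidX.1.
have QW v : fine (Q (W v)) = \prod_(j < m) q (v j).
  exact: (iidX.2 (fun j => Z @^-1` [set v j])).
have mzZ := measurable_finite_valued z mZ.
have mA : measurable [set w | a <= \sum_(j < m) z (Z (X j w))].
  rewrite -[X in measurable X]setTI; apply: measurable_fun_le => //.
  exact: (iid_measurable_sum mzZ).
(* The event is covered by the events [W v] for the value vectors [v] that it allows, each of
   product probability [QW]. *)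
apply: le_trans (fine_prob_union_le Q
    (P := fun v : {ffun 'I_m -> V} => a <= \sum_j z (v j)) mA mW _) _.
  move=> w /= aw; exists [ffun j => Z (X j w)].
    by under eq_bigr do rewrite ffunE.
  by move=> j; rewrite ffunE.
apply: le_trans (_ : _ <= \sum_(v : {ffun 'I_m -> V})
    expR (- (lam * a)) * \prod_(j < m) (q (v j) * expR (lam * z (v j)))) _.
  rewrite big_mkcond/=; apply: ler_sum => v _.
  have q0 j : 0 <= q (v j) by exact: fine_prob_ge0.
  case: ifP => [av|_]; last first.
    by rewrite mulr_ge0 ?expR_ge0// prodr_ge0// => j _; rewrite mulr_ge0 ?expR_ge0.
  (* Markov's inequality, vector by vector: [lam * (\sum_j z (v j) - a)] is nonnegative on the
     vectors kept, so the exponential factor is at least 1. *)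
  rewrite QW big_split/= mulrCA ler_peMr ?prodr_ge0//.
  rewrite -expR_sum -expRD -mulr_sumr -mulrN -mulrDr.
  by apply: le_trans (expR_ge1Dx _); rewrite lerDl mulr_ge0// addrC subr_ge0.
rewrite -mulr_sumr -(bigA_distr_bigA (fun=> fun v => q v * expR (lam * z v))).
by rewrite prodr_const card_ord.
Qed.

(** Since [|z| <= 1], the second moment of [z] is at most the mass [p] of its support, which plays
    the role of the variance. The exponent [- lam * u + 2 * lam ^+ 2 * p] is least at
    [lam = u / (4 * p)]; the range of [u] keeps [lam <= 2^-1], where [expR_le_quadratic] applies. *)
Lemma bernstein_finite_valued (V : finType) (Z : T -> V) (z : V -> R)
    (p u : R) : (forall v, measurable (Z @^-1` [set v])) ->
  (forall v, `|z v| <= 1) -> 0 < p ->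
  \sum_(v | z v != 0) fine (D (Z @^-1` [set v])) <= p ->
  0 <= u <= 2 * p ->
  fine (Q [set w | m%:R * (\int[D]_t z (Z t) + u) <= \sum_(j < m) z (Z (X j w))])
  <= expR (- (m%:R * u ^+ 2 / (8 * p))).
Proof.
move=> mZ z1 p0 zp /andP[u0 up]; pose lam := u / (4 * p).
have lam0 : 0 <= lam by rewrite divr_ge0//; lra.
have lam2 : lam <= 2^-1 by rewrite ler_pdivrMr; lra.
apply: le_trans (chernoff_finite_valued _ _ mZ lam0) _.
set e := \int[D]_t _; set q := fun v => fine (D (Z @^-1` [set v])).
have q0 v : 0 <= q v by exact: fine_prob_ge0.
have mgf : \sum_v q v * expR (lam * z v) <= expR (lam * e + 2 * lam ^+ 2 * p).
  apply: le_trans (expR_ge1Dx _).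
  apply: le_trans (_ : _ <= \sum_v (q v + lam * (z v * q v) +
      2 * lam ^+ 2 * (if z v != 0 then q v else 0))) _.
    apply: ler_sum => v _.
    have [z0|z0] := eqVneq (z v) 0.
      by rewrite z0 !mulr0 expR0 mul0r !mulr0 mulr1 !addr0.
    apply: le_trans (_ : _ <= q v * (1 + lam * z v + 2 * (lam * z v) ^+ 2)) _.
      rewrite ler_wpM2l// expR_le_quadratic//.
      apply: le_trans (_ : _ <= lam * 1) _; last by rewrite mulr1.
      by rewrite ler_wpM2l// (le_trans (ler_norm _)).
    have z21 : z v ^+ 2 <= 1 by rewrite -[_ ^+ 2]ger0_norm ?sqr_ge0// normrX expr_le1.
    have : 0 <= q v * (1 - z v ^+ 2) * lam ^+ 2.
      by rewrite mulr_ge0 ?exprn_ge0// mulr_ge0 ?subr_ge0//; exact: q0.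
    move: (z v) (q v) => x y /= h.
    rewrite -subr_ge0 (_ : _ - _ = 2 * (y * (1 - x ^+ 2) * lam ^+ 2)); last ring.
    by rewrite mulr_ge0.
  rewrite !big_split/= -!mulr_sumr sum_fine_prob_preimage// -big_mkcond/=.
  rewrite /e Rintegral_finite_valued// -addrA lerD2l lerD2l.
  by rewrite ler_wpM2l// mulr_ge0 ?exprn_ge0.
apply: le_trans (_ : _ <= expR (- (lam * (m%:R * (e + u)))) *
    expR (lam * e + 2 * lam ^+ 2 * p) ^+ m) _.
  rewrite ler_wpM2l ?expR_ge0// lerXn2r ?nnegrE ?expR_ge0//.
  by apply: sumr_ge0 => v _; apply: mulr_ge0; [exact: q0|exact: expR_ge0].
rewrite -expRM_natl -expRD ler_expR /lam -subr_ge0 le_eqVlt; apply/orP; left.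
by apply/eqP; field; lra.
Qed.

End Concentration.

Section Bernstein.
Variables (R : realType) (dO dT : measure_display).
Variables (Omega : measurableType dO) (T : measurableType dT).
Variables (Q : probability Omega R) (D : probability T R).
Variables (m : nat) (X : 'I_m -> Omega -> T).
Hypothesis iidX : iid_sample Q D X.

(** Rounding [F] down to a grid of mesh [N^-1 <= u / 2] reduces to the finite-valued case. The
    rounding costs half of [u], hence 32 in place of 8. *)
Lemma bernstein_upper (F : T -> R) (p u : R) : measurable_fun setT F ->
  (forall t, `|F t| <= 1) -> 0 < p -> fine (D [set t | F t != 0]) <= p ->
  0 < u <= 4 * p ->
  fine (Q [set w | m%:R * (\int[D]_t F t + u) <= \sum_(j < m) F (X j w)])
  <= expR (- (m%:R * u ^+ 2 / (32 * p))).
Proof.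
move=> mF F1 p0 Fp /andP[u0 up].
pose N := (Num.trunc (2 / u)).+1.
have N0 : 0 < N%:R :> R by rewrite ltr0n.
have Nu : N%:R^-1 <= u / 2.
  rewrite -[u / 2]invrK lef_pV2 ?posrE ?invr_gt0 ?divr_gt0//.
  by rewrite invf_div ltW// truncnS_gt.
pose y t := N%:R * F t + N%:R.
have y_itv t : 0 <= y t < (2 * N).+1%:R.
  have := F1 t; rewrite ler_norml => /andP[F1l F1r].
  rewrite /y -natr1 natrM; apply/andP; split; nra.
pose Z t : 'I_(2 * N).+1 := inord (Num.trunc (y t)).
pose z (v : 'I_(2 * N).+1) : R := (v%:R - N%:R) / N%:R.
have ZE t : (Z t : nat) = Num.trunc (y t).
  have /andP[y0 yN] := y_itv t.
  by rewrite inordK// truncn_lt_nat.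
have zZ t : z (Z t) <= F t < z (Z t) + N%:R^-1.
  have /andP[y0 _] := y_itv t; have /andP[] := truncn_itv y0.
  rewrite -natr1 {2 3}/y => a b; rewrite /z ZE; apply/andP; split.
    by rewrite ler_pdivrMr//; lra.
  by rewrite -ltrBlDr ltr_pdivlMr// mulrBl mulVf ?lt0r_neq0//; lra.
have my : measurable_fun setT y.
  by apply: measurable_funD => //; apply: measurable_funM.
have mZ v : measurable (Z @^-1` [set v]).
  have -> : Z @^-1` [set v] =
      (setT `&` [set t | v%:R <= y t]) `\` (setT `&` [set t | v.+1%:R <= y t]).
    apply/seteqP; split => t /=; have /andP[y0 _] := y_itv t.
      move=> Ztv; have /andP[] := truncn_itv y0; rewrite -ZE Ztv => a b.
      by split=> // -[_]; rewrite leNgt b.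
    move=> [[_ a] b]; apply/val_inj; rewrite /= ZE; apply: truncn_def.
    by rewrite a ltNge; apply/negP => h; apply: b.
  by apply: measurableD; exact: measurable_fun_le.
have z1 v : `|z v| <= 1.
  rewrite /z normrM normfV (ger0_norm (ltW N0)) ler_pdivrMr// mul1r ler_norml.
  have : (v <= 2 * N)%N by rewrite -ltnS.
  rewrite -(ler_nat R) natrM; have : 0 <= v%:R :> R by [].
  by move=> *; apply/andP; split; lra.
have mF0 : measurable [set t | F t != 0].
  have -> : [set t | F t != 0] = F @^-1` (~` [set 0]).
    by apply/seteqP; split => t /= /eqP.
  rewrite -[X in measurable X]setTI; apply: mF => //.
  exact: measurableC.
have zp : \sum_(v | z v != 0) fine (D (Z @^-1` [set v])) <= p.
  apply: le_trans Fp; rewrite -Rintegral_indic// big_mkcond/=.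
  have := Rintegral_finite_valued D (fun v => (z v != 0)%:R) mZ.
  under [X in _ = X]eq_bigr do rewrite mulrC mulr_natr mulrb.
  move=> <-; apply: le_Rintegral => //.
  - apply: (@bounded_integrable _ _ _ _ _ 1).
      exact: measurable_finite_valued (fun v => (z v != 0)%:R) mZ.
    by move=> t; case: (_ != _); rewrite /= ?normr1 ?normr0.
  - apply: (@bounded_integrable _ _ _ _ _ 1); first exact: measurable_indic.
    exact: indic_norm_le1.
  move=> t _; rewrite indicE.
  have [Ft0|Ft0] := eqVneq (F t) 0; last by rewrite mem_set// lern1 leq_b1.
  (* Where [F] vanishes, [y] is the integer [N]: zero lies on the grid, so rounding does not enlarge
     the support. *)
  suff -> : z (Z t) = 0 by rewrite eqxx.
  by rewrite /z ZE /y Ft0 mulr0 add0r natrK subrr mul0r.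
have u2 : 0 <= u / 2 <= 2 * p by apply/andP; split; lra.
apply: le_trans (le_trans (bernstein_finite_valued iidX mZ z1 p0 zp u2) _);
  last by rewrite ler_expR le_eqVlt; apply/orP; left; apply/eqP; field; lra.
have mzZ := measurable_finite_valued z mZ.
apply: le_fine_prob.
- rewrite -[X in measurable X]setTI; apply: measurable_fun_le => //.
  exact: (iid_measurable_sum iidX mF).
- rewrite -[X in measurable X]setTI; apply: measurable_fun_le => //.
  exact: (iid_measurable_sum iidX mzZ).
move=> w /= Fw.
have eF : \int[D]_t z (Z t) <= \int[D]_t F t.
  apply: le_Rintegral => //.
  - by apply: (@bounded_integrable _ _ _ _ _ 1).
  - by apply: (@bounded_integrable _ _ _ _ _ 1).
  by move=> t _; have /andP[] := zZ t.
have Fz : \sum_(j < m) F (X j w) <= \sum_(j < m) z (Z (X j w)) + m%:R * (u / 2).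
  rewrite mulr_natl -[X in _ *+ X]card_ord -sumr_const -big_split/=.
  by apply: ler_sum => j _; have /andP[_] := zZ (X j w); lra.
have : m%:R * (\int[D]_t z (Z t)) <= m%:R * (\int[D]_t F t) by rewrite ler_wpM2l.
move: Fw Fz; rewrite !mulrDr; lra.
Qed.

Lemma bernstein (F : T -> R) (p u : R) : measurable_fun setT F ->
  (forall t, `|F t| <= 1) -> 0 < p -> fine (D [set t | F t != 0]) <= p ->
  0 < u <= 4 * p ->
  fine (Q [set w | m%:R * u <= `|\sum_(j < m) F (X j w) - m%:R * \int[D]_t F t|])
  <= 2 * expR (- (m%:R * u ^+ 2 / (32 * p))).
Proof.
move=> mF F1 p0 Fp up.
have mNF : measurable_fun setT (fun t => - F t) by exact: measurableT_comp.
have NF1 t : `|- F t| <= 1 by rewrite normrN.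
have NFp : fine (D [set t | - F t != 0]) <= p.
  by under eq_set do rewrite oppr_eq0.
have h1 := bernstein_upper mF F1 p0 Fp up.
have h2 := bernstein_upper mNF NF1 p0 NFp up.
have iF : D.-integrable setT (EFin \o F) by exact: (@bounded_integrable _ _ _ _ _ 1).
have eN : \int[D]_t (- F t) = - \int[D]_t F t.
  by under eq_Rintegral do rewrite -mulN1r; rewrite RintegralZl// mulN1r.
have mS := iid_measurable_sum iidX mF.
have mNS := iid_measurable_sum iidX mNF.
pose B (b : bool) : set Omega := if b then
    [set w | m%:R * (\int[D]_t F t + u) <= \sum_(j < m) F (X j w)] else
    [set w | m%:R * (\int[D]_t (- F t) + u) <= \sum_(j < m) - F (X j w)].
apply: le_trans (fine_prob_union_le Q (P := xpredT) (B := B) _ _ _) _.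
- rewrite -[X in measurable X]setTI; apply: measurable_fun_le => //.
  apply: measurableT_comp => //; exact: measurable_funB.
- by case; rewrite /B -[X in measurable X]setTI; apply: measurable_fun_le.
- move=> w /=; rewrite ler_normr => /orP[h|h].
    by exists true => //=; rewrite mulrDr; lra.
  by exists false => //=; rewrite eN sumrN mulrDr mulrN; lra.
by rewrite big_bool/= mulrDl mul1r lerD.
Qed.

End Bernstein.

(** * Equilibria and losses through indifference thresholds *)

Section GameStructure.
Variables (R : realType) (n : nat).
Implicit Types (G : cmgame R n) (sigma : 'I_n -> R) (s : profile n).

(** The subsidies paid cancel in the objective, so [sigma] acts only through the set of
    equilibria. *)
Lemma avg_lossE G sigma :
  avg_loss G sigma = (#|NE_set G sigma|%:R)^-1 *
    \sum_(s in NE_set G sigma) \sum_(i < n) cm_loss G i s.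
Proof.
rewrite /avg_loss; congr (_ * _); apply: eq_bigr => s _.
rewrite /cost_sigma /subs -big_split/=; apply: eq_bigr => i _.
by rewrite /subs_cost subrK.
Qed.

(* The subsidy at which agent [i] is indifferent between repairing or not,
   the other agents playing according to [s]. *)
Definition threshold G (i : 'I_n) s : R :=
  cm_cost G i - (exp_phi G (deviate s i true) - exp_phi G (deviate s i false)).

Lemma deviate_id s (i : 'I_n) : deviate s i (s i) = s.
Proof. by apply/ffunP => j; rewrite ffunE; case: eqP => [->|]. Qed.

Lemma is_pure_NE_threshold G sigma s : is_pure_NE G sigma s =
  [forall i, if s i then threshold G i s <= sigma i else sigma i <= threshold G i s].
Proof.
apply: eq_forallb => i.
have cE b : subs_cost G sigma i (deviate s i b) =
    cm_cost G i * b%:R + 1 - exp_phi G (deviate s i b) - sigma i * b%:R.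
  by rewrite /subs_cost /cm_loss /subs_i ffunE eqxx.
(* Both sides of the best-response inequality now have the form treated by [cE]; only the flip
   [~~ s i] carries information. *)
rewrite -{1}[s](deviate_id s i) /threshold.
apply/forallP/idP => [/(_ (~~ s i))|h b].
  by case: (s i) => /=; rewrite !cE/=; lra.
by move: h; case: (s i) b => -[] /=; rewrite !cE/= => *; lra.
Qed.

(** Both weak comparisons are recorded because, at a tie, repairing and not repairing are both best
    responses. *)
Lemma eq_avg_loss G sigma sigma' :
  (forall i s, (threshold G i s <= sigma i) = (threshold G i s <= sigma' i) /\
    (sigma i <= threshold G i s) = (sigma' i <= threshold G i s)) ->
  avg_loss G sigma = avg_loss G sigma'.
Proof.
move=> h; rewrite !avg_lossE.
suff -> : NE_set G sigma = NE_set G sigma' by [].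
apply/setP => s; rewrite !inE !is_pure_NE_threshold.
by apply: eq_forallb => i; have [-> ->] := h i s.
Qed.

Lemma exp_phi_itv G s : (forall i, 0 <= cm_prior G i <= 1) ->
  0 <= exp_phi G s <= 1.
Proof.
move=> prior01.
have f0 i (b : bool) : 0 <= if b then cm_prior G i else 1 - cm_prior G i.
  by have := prior01 i; case: b => /andP[]; lra.
have p0 x : 0 <= prior_prob G x by apply: prodr_ge0 => i _; exact: f0.
have p1 : \sum_x prior_prob G x = 1.
  rewrite -(bigA_distr_bigA (fun i (b : bool) =>
    if b then cm_prior G i else 1 - cm_prior G i)) big1// => i _.
  by rewrite big_bool/= addrC subrK.
apply/andP; split; first by apply: sumr_ge0 => x _; rewrite mulr_ge0.
rewrite -p1; apply: ler_sum => x _.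
by rewrite ler_piMr// lern1 leq_b1.
Qed.

Lemma avg_loss_itv G sigma (H : R) : 1 <= H ->
  (forall i, 0 <= cm_prior G i <= 1 /\ 0 <= cm_cost G i <= H) ->
  0 <= avg_loss G sigma <= 2 * n%:R * H.
Proof.
move=> H1 vG.
(* An agent loses at most [H + 1], and [1 <= H] turns this into [2 * H]. *)
have l01 i s : 0 <= cm_loss G i s <= 2 * H.
  have /andP[e0 e1] := exp_phi_itv s (fun i => (vG i).1).
  by rewrite /cm_loss; have [_ /andP[]] := vG i; case: (s i) => /=; lra.
have L0 s : 0 <= \sum_(i < n) cm_loss G i s.
  by apply: sumr_ge0 => i _; have /andP[] := l01 i s.
have L1 s : \sum_(i < n) cm_loss G i s <= 2 * n%:R * H.
  apply: le_trans (_ : _ <= \sum_(i < n) 2 * H) _.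
    by apply: ler_sum => i _; have /andP[] := l01 i s.
  by rewrite sumr_const card_ord -mulr_natr; lra.
rewrite avg_lossE; apply/andP; split.
  by rewrite mulr_ge0 ?invr_ge0// sumr_ge0.
(* On an empty set of equilibria the average is 0, by the convention [0^-1 = 0]. *)
have [->|NE0] := posnP #|NE_set G sigma|.
  by rewrite invr0 mul0r !mulr_ge0//; lra.
rewrite ler_pdivrMl ?ltr0n//.
apply: le_trans (_ : _ <= \sum_(s in NE_set G sigma) 2 * n%:R * H) _.
  exact: ler_sum.
by rewrite sumr_const -[X in X <= _]mulr_natl.
Qed.

End GameStructure.

(** * Measurability of the loss as a function of the game *)

Section GameMeasurability.
Variables (R : realType) (n : nat) (d : measure_display).
Variables (T : measurableType d) (g : T -> cmgame R n).
Hypothesis mg : measurable_games g.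

Lemma measurable_exp_phi s : measurable_fun setT (fun t => exp_phi (g t) s).
Proof.
have [mprior _ mphi] := mg.
apply: measurable_sum => x; apply: measurable_funM.
  apply: measurable_prod => i _; case: (x i) => //.
  exact: measurable_funB.
exact: (measurable_finite_valued (fun f : {ffun profile n -> bool} =>
  (f (post_state x s))%:R) mphi).
Qed.

Lemma measurable_cm_loss i s : measurable_fun setT (fun t => cm_loss (g t) i s).
Proof.
have [_ mcost _] := mg.
apply: measurable_funB; last exact: measurable_exp_phi.
by apply: measurable_funD => //; apply: measurable_funM.
Qed.

Lemma measurable_threshold i s :
  measurable_fun setT (fun t => threshold (g t) i s).
Proof.
have [_ mcost _] := mg.
by apply: measurable_funB => //; apply: measurable_funB; exact: measurable_exp_phi.
Qed.

Lemma measurable_NE_set sigma (S : {set profile n}) :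
  measurable [set t | NE_set (g t) sigma = S].
Proof.
pose N s : set T := [set t | is_pure_NE (g t) sigma s].
have mN s : measurable (N s).
  have -> : N s = \bigcap_(i in setT) [set t | if s i
      then threshold (g t) i s <= sigma i else sigma i <= threshold (g t) i s].
    apply/seteqP; split => t /=; rewrite /N/= is_pure_NE_threshold.
      by move/forallP => h i _; exact: h.
    by move=> h; apply/forallP => i; exact: (h i I).
  apply: fin_bigcap_measurable; [exact: finite_finset|move=> i _].
  rewrite -[X in measurable X]setTI.
  by case: (s i); apply: measurable_fun_le => //; exact: measurable_threshold.
have -> : [set t | NE_set (g t) sigma = S] =
    \bigcap_(s in setT) (if s \in S then N s else ~` N s).
  apply/seteqP; split => t /=.
    by move=> <- s _; rewrite inE /N; case: ifP => //= ->.
  move=> h; apply/setP => s; have := h s I; rewrite inE /N.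
  by case: ifP => //= _ /negP/negbTE.
apply: fin_bigcap_measurable; [exact: finite_finset|move=> s _].
by case: ifP => // _; exact: measurableC.
Qed.

(** The set of equilibria varies with [t]. Splitting over its finitely many possible values [S]
    leaves sums over a fixed index set, weighted by indicators. *)
Lemma measurable_avg_loss sigma :
  measurable_fun setT (fun t => avg_loss (g t) sigma).
Proof.
have -> : (fun t => avg_loss (g t) sigma) = (fun t => \sum_(S : {set profile n})
    (NE_set (g t) sigma == S)%:R *
    ((#|S|%:R)^-1 * \sum_(s <- enum S) \sum_(i < n) cm_loss (g t) i s)).
  apply/funext => t; rewrite avg_lossE (bigD1 (NE_set (g t) sigma))//= eqxx mul1r.
  rewrite big_enum [X in _ = _ + X]big1 ?addr0// => S.
  by rewrite eq_sym => /negbTE ->; rewrite mul0r.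
apply: measurable_sum => S; apply: measurable_funM.
  exact: (measurable_finite_valued (fun S' => (S' == S)%:R)
    (measurable_NE_set sigma)).
apply: measurable_funM => //; apply: measurable_sum => s; apply: measurable_sum => i.
exact: measurable_cm_loss.
Qed.

End GameMeasurability.

(** * Partition of the subsidy box into cells of nearly constant loss *)

Lemma cofinal_sequence (R : realType) (S : set R) : has_sup S ->
  exists w : nat -> R, [/\ forall k, S (w k), nondecreasing_seq w &
    forall x, S x -> exists k, x <= w k].
Proof.
move=> supS; have [[y0 Sy0] _] := supS.
have [[M [SM leM]]|nomax] := pselect (exists M, S M /\ forall x, S x -> x <= M).
  by exists (fun=> M); split=> // x /leM; exists 0%N.
have /choice [w wP] : forall k : nat, exists y, S y /\ sup S - k.+1%:R^-1 < y.
  move=> k; have k0 : 0 < k.+1%:R^-1 :> R by rewrite invr_gt0.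
  by have [y Sy ?] := sup_adherent k0 supS; exists y.
(* Running maxima make the sequence of near-suprema monotone while staying in [S]. *)
exists (fun k => iteri k (fun i y => Num.max y (w i)) y0); split.
- elim=> //= k IH; rewrite /Num.max; case: ifP => // _; exact: (wP k).1.
- by apply/nondecreasing_seqP => k /=; rewrite le_max lexx.
move=> x Sx.
(* Without a maximum, [x] lies strictly below the supremum, so some [w k] passes it. *)
have [y [Sy xy]] : exists y, S y /\ x < y.
  apply: contrapT => h; apply: nomax; exists x; split => // y Sy.
  by rewrite leNgt; apply/negP => xy; apply: h; exists y.
have yS : y <= sup S by apply: sup_upper_bound.
have xS : 0 < sup S - x by lra.
exists (Num.trunc (sup S - x)^-1).+1 => /=.
apply: le_trans (_ : _ <= w (Num.trunc (sup S - x)^-1)) _.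
  have [_] := wP (Num.trunc (sup S - x)^-1).
  have : (Num.trunc (sup S - x)^-1).+1%:R^-1 <= sup S - x.
    rewrite -[leRHS]invrK lef_pV2 ?posrE ?invr_gt0//.
    by rewrite ltW// truncnS_gt.
  by move=> h1 /ltW; apply: le_trans; rewrite lerBrDr -lerBrDl.
by rewrite le_max lexx orbT.
Qed.

Section CoordinatePartition.
Variables (R : realType) (d : measure_display) (T : measurableType d).
Variables (D : probability T R) (V : finType) (tau : V -> T -> R).
Hypothesis mtau : forall v, measurable_fun setT (tau v).

(** The expected numbers of thresholds below [x], strictly for [a] and weakly for [b]; their
    difference is the expected number of thresholds sitting at [x]. *)
Let a (x : R) : R := \sum_v fine (D [set t | tau v t < x]).
Let b (x : R) : R := \sum_v fine (D [set t | tau v t <= x]).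

Let measurable_tau_itv v (S : set R) : is_interval S ->
  measurable [set t | S (tau v t)].
Proof.
move=> iS; rewrite -[X in measurable X]setTI.
by apply: mtau => //; exact: is_interval_measurable.
Qed.

Let measurable_tau_lt v x : measurable [set t | tau v t < x].
Proof.
apply: (@measurable_tau_itv v [set y | y < x]) => y z /= _ zx u /andP[_ uz].
exact: le_lt_trans uz zx.
Qed.

Let measurable_tau_le v x : measurable [set t | tau v t <= x].
Proof.
apply: (@measurable_tau_itv v [set y | y <= x]) => y z /= _ zx u /andP[_ uz].
exact: le_trans uz zx.
Qed.

Let measurable_tau_bounds v x y : measurable [set t | x <= tau v t <= y].
Proof.
apply: (@measurable_tau_itv v [set z | x <= z <= y]) => z z' /=.
move=> /andP[xz _] /andP[_ z'y] u /andP[zu uz'].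
by rewrite (le_trans xz)//= (le_trans uz').
Qed.

Let a_le_b x : a x <= b x.
Proof.
by apply: ler_sum => v _; apply: le_fine_prob => // t /=; exact: ltW.
Qed.

Let b_le_a x y : x < y -> b x <= a y.
Proof.
move=> xy; apply: ler_sum => v _; apply: le_fine_prob => // t /= tx.
exact: le_lt_trans tx xy.
Qed.

Let a_ge0 x : 0 <= a x.
Proof. by apply: sumr_ge0 => v _; exact: fine_prob_ge0. Qed.

Let a_le_card x : a x <= #|V|%:R.
Proof.
rewrite -sumr_const; apply: ler_sum => v _; exact: fine_prob_le1.
Qed.

Let closed_mass x y : x <= y ->
  \sum_v fine (D [set t | x <= tau v t <= y]) = b y - a x.
Proof.
move=> xy; rewrite /b /a -sumrB; apply: eq_bigr => v _.
have -> : [set t | tau v t <= y] =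
    [set t | tau v t < x] `|` [set t | x <= tau v t <= y].
  apply/seteqP; split => t /=.
    by move=> ->; rewrite andbT; case: ltP; [left|right].
  by case=> [/ltW/le_trans -> //|/andP[]].
rewrite measureU//; last first.
  by apply/seteqP; split => t //= -[tx /andP[]]; rewrite leNgt tx.
by rewrite fineD ?fin_num_measure// addrC addKr.
Qed.

(** [S] may be open or closed at either end, so it is exhausted by closed intervals with endpoints
    in [S], where the hypothesis applies; continuity from below gives the limit. *)
Lemma interval_mass_le (S : set R) (q : R) : is_interval S -> has_ubound S ->
  has_lbound S -> 0 <= q -> (forall x y, S x -> S y -> x <= y -> b y - a x <= q) ->
  \sum_v fine (D [set t | S (tau v t)]) <= q.
Proof.
move=> iS ubS lbS q0 Sq.
have [[x0 Sx0]|S0] := pselect (S !=set0); last first.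
  rewrite big1// => v _.
  rewrite (_ : [set t | _] = set0) ?measure0//.
  by apply/seteqP; split => t //= St; apply: S0; exists (tau v t).
have supS : has_sup S by split => //; exists x0.
(* The left endpoints are minus a cofinal sequence of the reflected set. *)
have supNS : has_sup (-%R @` S).
  by apply/has_inf_supN; split => //; exists x0.
have [hi [Shi ndhi cofhi]] := cofinal_sequence supS.
have [lo [Slo ndlo coflo]] := cofinal_sequence supNS.
have SNlo k : S (- lo k) by have [y Sy <-] := Slo k; rewrite opprK.
pose B k v := [set t | - lo k <= tau v t <= hi k].
have BS v : \bigcup_k B k v = [set t | S (tau v t)].
  apply/seteqP; split => t /=.
    by move=> [k _ /= h]; exact: iS (SNlo k) (Shi k) _ h.
  move=> St; have [k1 h1] := cofhi _ St.
  have [k2 h2] : exists k, - tau v t <= lo k by apply: coflo; exists (tau v t).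
  exists (maxn k1 k2) => //=; apply/andP; split.
    by rewrite lerNl (le_trans h2)// ndlo// leq_maxr.
  by rewrite (le_trans h1)// ndhi// leq_maxl.
have ndB v : {homo (fun k => B k v) : k l / (k <= l)%N >-> (k <= l)%O}.
  move=> k l kl; apply/subsetPset => t /= /andP[h1 h2]; apply/andP; split.
    by apply: le_trans h1; rewrite lerN2 ndlo.
  by apply: le_trans h2 _; rewrite ndhi.
have cvgB : (fun k => \sum_v D (B k v)) @ \oo -->
    (\sum_v D [set t | S (tau v t)])%E.
  apply: cvg_nnesum => [v _|v _]; first by apply: nearW => k; exact: measure_ge0.
  rewrite -BS; apply: nondecreasing_cvg_mu => //.
    by move=> k; exact: measurable_tau_bounds.
  by rewrite BS; exact: measurable_tau_itv.
have finS v : D [set t | S (tau v t)] \is a fin_num.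
  by rewrite fin_num_measure//; exact: measurable_tau_itv.
rewrite -lee_fin -sumEFin; under eq_bigr => v _ do rewrite (fineK (finS v)).
rewrite -(cvg_lim _ cvgB)//; apply: lime_le; first by apply/cvg_ex; eexists; exact: cvgB.
apply: nearW => k.
have finB v : D (B k v) \is a fin_num.
  by rewrite fin_num_measure//; exact: measurable_tau_bounds.
under eq_bigr => v _ do rewrite -(fineK (finB v)).
rewrite sumEFin lee_fin.
have [lohi|lohi] := leP (- lo k) (hi k).
  by rewrite closed_mass//; apply: Sq.
rewrite big1// => v _.
rewrite (_ : B k v = set0) ?measure0//.
by apply/seteqP; split => t //= /andP[h1 h2]; move: (le_trans h1 h2); rewrite leNgt lohi.
Qed.

(* Cutting the line at the [M^-1]-quantiles of the expected number of
   thresholds; the boolean is false at the points whose atom straddles a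
   quantile, which are alone in their cell. *)
Lemma coordinate_partition (M : nat) (H : R) : (0 < M)%N ->
  exists (cell : R -> 'I_(#|V| * M).+1 * bool)
      (A : 'I_(#|V| * M).+1 * bool -> set T),
    [/\ forall c, measurable (A c), forall c, fine (D (A c)) <= M%:R^-1 &
      forall x y t, 0 <= x <= H -> 0 <= y <= H -> cell x = cell y ->
        ~ A (cell x) t -> forall v, (tau v t <= x) = (tau v t <= y) /\
          (x <= tau v t) = (y <= tau v t)].
Proof.
move=> M0; have M0R : 0 < M%:R :> R by rewrite ltr0n.
pose ka x := Num.trunc (a x * M%:R); pose kb x := Num.trunc (b x * M%:R).
have b_ge0 x : 0 <= b x := le_trans (a_ge0 x) (a_le_b x).
have kab x : (ka x <= kb x)%N by apply: le_truncn; rewrite ler_pM2r.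
have kba x y : x < y -> (kb x <= ka y)%N.
  by move=> xy; apply: le_truncn; rewrite ler_pM2r// b_le_a.
have kaV x : (ka x < (#|V| * M).+1)%N.
  rewrite /ka truncn_lt_nat ?mulr_ge0//.
  apply: le_lt_trans (_ : #|V|%:R * M%:R < _); first by rewrite ler_pM2r.
  by rewrite -natrM ltr_nat.
pose cell x : 'I_(#|V| * M).+1 * bool := (inord (ka x), ka x == kb x).
have cellP x y : cell x = cell y -> ka x = ka y /\ (ka x == kb x) = (ka y == kb y).
  by case=> /(congr1 val) /=; rewrite !inordK.
pose S c : set R := [set x | 0 <= x <= H /\ cell x = c].
(* The chain [ka x <= kb x <= ka y = ka x] forces the boolean of a shared cell to be true, whence
   [kb y = ka y] as well. *)
have cell_lt x y : cell x = cell y -> x < y -> kb y = ka x.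
  move=> /cellP[kxy kk] xy.
  have kx : ka x == kb x by rewrite eqn_leq kab/= kxy kba.
  by move: kk; rewrite kx => /esym/eqP <-; rewrite kxy.
have iS c : is_interval (S c).
  move=> x y [/andP[x0 xH] cx] [/andP[y0 yH] cy] z /andP[xz zy].
  move: xz; rewrite le_eqVlt => /predU1P[<-|xz]; first by rewrite /S/= x0.
  move: zy; rewrite le_eqVlt => /predU1P[->|zy]; first by rewrite /S/= y0.
  split; first by rewrite (ltW (le_lt_trans x0 xz)) (ltW (lt_le_trans zy yH)).
  have cxy : cell x = cell y by rewrite cx cy.
  have kk := cell_lt _ _ cxy (lt_trans xz zy).
  have h1 := kba _ _ xz; have h2 := kba _ _ zy.
  have h3 := kab x; have h4 := kab z; have h5 := kab y.
  have zx : ka z = ka x by lia.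
  have xx : kb x = ka x by lia.
  have zz : kb z = ka x by lia.
  by rewrite -cx /cell zx zz xx.
exists cell, (fun c => if c.2 then \bigcup_(v in setT) [set t | S c (tau v t)] else set0).
have mU c v : measurable [set t | S c (tau v t)] by exact: measurable_tau_itv.
have mA c : measurable (\bigcup_(v in setT) [set t | S c (tau v t)]).
  by apply: fin_bigcup_measurable => [|v _ //]; exact: finite_finset.
split.
- by move=> c; case: ifP.
- move=> c; case: ifP => [c2|_]; last by rewrite measure0 invr_ge0.
  apply: le_trans (fine_prob_union_le D (P := xpredT) (mA c) (mU c) _) _.
    by move=> t [v _ h]; exists v.
  apply: interval_mass_le => //.
  + by exists H => x [/andP[]].
  + by exists 0 => x [/andP[]].
  (* [a x * M%:R] and [b y * M%:R] have the same integer part, so they differ by less than 1. *)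
  move=> x y [_ cx] [_ cy] xy.
  have kxy : kb y = ka x.
    move: xy; rewrite le_eqVlt => /predU1P[<-|]; last by apply: cell_lt; rewrite cx.
    by apply/esym/eqP; move: c2; rewrite -cx.
  rewrite -[leRHS]mul1r ler_pdivlMr// mulrBl.
  have /truncn_itv/andP[h1 _] : 0 <= a x * M%:R by rewrite mulr_ge0.
  have /truncn_itv/andP[_] : 0 <= b y * M%:R by rewrite mulr_ge0.
  by rewrite -/(kb y) kxy -natr1 /ka; lra.
move=> x y t xH yH cxy nA v.
wlog xy : x y xH yH cxy nA / x < y.
  move=> wl; case: (ltgtP x y) => [|yx|->//]; first exact: wl.
  by have [] := wl y x yH xH (esym cxy) _ yx; rewrite -?cxy.
case: ifP nA => [c2 nA|/negP[]]; last first.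
  rewrite /cell/= eqn_leq kab/=; have [-> _] := cellP _ _ cxy; exact: kba.
(* No threshold lies in the cell, an interval containing [x] and [y]; hence none separates or meets
   them. *)
have nS : ~ S (cell x) (tau v t) by move=> h; apply: nA; exists v.
have Sx : S (cell x) x by [].
have Sy : S (cell x) y by [].
have [tx|tx] := ltP (tau v t) x.
  by rewrite (ltW tx) (ltW (lt_trans tx xy)) leNgt (lt_trans tx xy).
have [ty|ty] := ltP y (tau v t).
  by rewrite (ltW ty) leNgt (lt_trans xy ty).
by exfalso; apply: nS; apply: (iS _ _ _ Sx Sy); rewrite tx.
Qed.

End CoordinatePartition.

(** Product of the partitions of the axes. Each axis is cut at precision [n * P], so that the union
    bound over the [n] agents leaves probability [P^-1]. *)
Lemma game_cover (R : realType) (n : nat) (d : measure_display)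
    (T : measurableType d) (D : probability T R) (g : T -> cmgame R n)
    (H : R) (P : nat) : (0 < n)%N -> (0 < P)%N -> 0 <= H -> measurable_games g ->
  exists (I : finType) (cell : ('I_n -> R) -> I) (rep : I -> 'I_n -> R)
      (A : I -> set T),
    [/\ (#|I| <= (2 * 4 ^ n * P) ^ n)%N, forall c, in_box H (rep c),
      forall c, measurable (A c), forall c, fine (D (A c)) <= P%:R^-1 &
      forall sigma t, in_box H sigma -> ~ A (cell sigma) t ->
        avg_loss (g t) sigma = avg_loss (g t) (rep (cell sigma))].
Proof.
move=> n0 P0 H0 mg; have M0 : (0 < n * P)%N by rewrite muln_gt0 n0.
pose J := ('I_(#|{: profile n}| * (n * P)).+1 * bool)%type.
pose good (i : 'I_n) (cA : (R -> J) * (J -> set T)) :=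
  [/\ forall c, measurable (cA.2 c), forall c, fine (D (cA.2 c)) <= (n * P)%:R^-1 &
      forall x y t, 0 <= x <= H -> 0 <= y <= H -> cA.1 x = cA.1 y ->
        ~ cA.2 (cA.1 x) t -> forall s,
          (threshold (g t) i s <= x) = (threshold (g t) i s <= y) /\
          (x <= threshold (g t) i s) = (y <= threshold (g t) i s)].
have /choice [cA cAP] : forall i, exists cA, good i cA.
  move=> i; have [cell [A h]] := coordinate_partition D
    (fun s => measurable_threshold mg i s) H M0.
  by exists (cell, A).
pose cell (sigma : 'I_n -> R) : {ffun 'I_n -> J} := [ffun i => (cA i).1 (sigma i)].
(* Cells that miss the box get the zero vector, which keeps every representative in the box. *)
have /choice [rep repP] : forall c, exists r : 'I_n -> R, in_box H r /\
    ((exists2 sigma, in_box H sigma & cell sigma = c) -> cell r = c).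
  move=> c; have [[r rH rc]|nr] := pselect (exists2 sigma, in_box H sigma & cell sigma = c).
    by exists r.
  by exists (fun=> 0); split => // i; rewrite lexx.
pose A (c : {ffun 'I_n -> J}) : set T := \bigcup_(i in setT) (cA i).2 (c i).
have mAi i c : measurable ((cA i).2 c) by have [] := cAP i.
have mA c : measurable (A c).
  by apply: fin_bigcup_measurable => [|i _ //]; exact: finite_finset.
exists {ffun 'I_n -> J}, cell, rep, A; split => //.
- rewrite card_ffun card_ord card_prod card_ord card_bool leq_exp2r//.
  rewrite card_ffun card_bool card_ord mulnC -mulnA leq_pmul2l//.
  have -> : (4 ^ n = 2 ^ n * 2 ^ n)%N by rewrite -expnMn.
  have n2 : (n < 2 ^ n)%N by exact: ltn_expl.
  (* The extra 1 is at most [2 ^ n * P], and then [n + 1 <= 2 ^ n]. *)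
  rewrite mulnA -addn1 (@leq_trans (2 ^ n * n * P + 2 ^ n * P)%N)//.
    by rewrite leq_add2l muln_gt0 expn_gt0.
  by rewrite -mulnDl -[X in (_ + X)%N]muln1 -mulnDr addn1 leq_mul2r leq_mul2l n2 !orbT.
- by move=> c; exact: (repP c).1.
- move=> c; apply: le_trans (fine_prob_union_le D (P := xpredT) (mA c)
    (fun i => mAi i (c i)) _) _.
    by move=> t [i _ h]; exists i.
  apply: le_trans (_ : _ <= \sum_(i < n) (n * P)%:R^-1) _.
    by apply: ler_sum => i _; have [_ h _] := cAP i.
  rewrite sumr_const card_ord natrM invfM -[_ *+ n]mulr_natl mulrA divff ?mul1r//.
  by rewrite pnatr_eq0 -lt0n.
move=> sigma t sH nA; apply: eq_avg_loss => i s.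
have [rH rc] := repP (cell sigma).
have /(congr1 (fun f : {ffun 'I_n -> J} => f i)) : cell (rep (cell sigma)) = cell sigma.
  by apply: rc; exists sigma.
rewrite ![in X in X -> _]ffunE => /esym ci.
have [_ _ h] := cAP i; apply: h => //.
by move=> At; apply: nA; exists i => //=; rewrite ffunE.
Qed.

(** * Chaining along a sequence of covers *)

Section Chaining.
Variables (R : realType) (dO dT : measure_display).
Variables (Omega : measurableType dO) (T : measurableType dT).
Variables (Q : probability Omega R) (D : probability T R).
Variables (m : nat) (X : 'I_m -> Omega -> T).
Hypothesis iidX : iid_sample Q D X.

Definition deviation (F : T -> R) (w : Omega) : R :=
  \sum_(j < m) F (X j w) - m%:R * \int[D]_t F t.

Lemma deviationB (F F' : T -> R) (w : Omega) :
  measurable_fun setT F -> (forall t, `|F t| <= 1) ->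
  measurable_fun setT F' -> (forall t, `|F' t| <= 1) ->
  deviation (fun t => F t - F' t) w = deviation F w - deviation F' w.
Proof.
move=> mF F1 mF' F1'; rewrite /deviation RintegralB//.
- by rewrite sumrB; ring.
- exact: (bounded_integrable _ mF F1).
- exact: (bounded_integrable _ mF' F1').
Qed.

(** Handles the last approximation error: infinitely many functions [F] supported in the same [A]
    are controlled by the single deviation of its indicator. The mass of [A] enters once from the
    sample sum and once from the mean. *)
Lemma deviation_le_indic (F : T -> R) (A : set T) (w : Omega) :
  measurable_fun setT F -> measurable A -> (forall t, `|F t| <= \1_A t) ->
  `|deviation F w| <= deviation \1_A w + 2 * (m%:R * fine (D A)).
Proof.
move=> mF mA FA; rewrite /deviation Rintegral_indic//.
have F1 t : `|F t| <= 1 :=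
  le_trans (FA t) (le_trans (ler_norm _) (indic_norm_le1 R A t)).
have iF := bounded_integrable D mF F1.
have sF : `|\sum_(j < m) F (X j w)| <= \sum_(j < m) \1_A (X j w).
  by apply: le_trans (ler_norm_sum _ _ _) _; apply: ler_sum => j _.
have eF : `|m%:R * \int[D]_t F t| <= m%:R * fine (D A).
  rewrite normrM ger0_norm// ler_wpM2l// -Rintegral_indic//.
  apply: le_trans (le_normr_Rintegral _ iF) _ => //.
  apply: le_Rintegral => //.
  - apply: (@bounded_integrable _ _ _ _ _ 1); first exact: measurableT_comp.
    by move=> t; rewrite normr_id.
  - apply: (@bounded_integrable _ _ _ _ _ 1); first exact: measurable_indic.
    exact: indic_norm_le1.
apply: le_trans (ler_normB _ _) _; lra.
Qed.

Lemma finite_deviation_event (I : finType) (F : I -> T -> R) (p u : R) :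
  (forall c, measurable_fun setT (F c)) -> (forall c t, `|F c t| <= 1) -> 0 < p ->
  (forall c, fine (D [set t | F c t != 0]) <= p) -> 0 < u <= 4 * p ->
  exists E : set Omega, [/\ measurable E,
    fine (Q (~` E)) <= #|I|%:R * (2 * expR (- (m%:R * u ^+ 2 / (32 * p)))) &
    forall w c, E w -> `|deviation (F c) w| <= m%:R * u].
Proof.
move=> mF F1 p0 Fp up.
pose B c : set Omega := [set w | m%:R * u <= `|deviation (F c) w|].
have mB c : measurable (B c).
  rewrite -[X in measurable X]setTI; apply: measurable_fun_le => //.
  apply: measurableT_comp => //; apply: measurable_funB => //.
  exact: (iid_measurable_sum iidX (mF c)).
have mU : measurable (\bigcup_(c in setT) B c).
  by apply: fin_bigcup_measurable => [|c _ //]; exact: finite_finset.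
exists (~` \bigcup_(c in setT) B c); split; first exact: measurableC.
- rewrite setCK.
  apply: le_trans (fine_prob_union_le Q (P := xpredT) mU mB _) _.
    by move=> w [c _ h]; exists c.
  rewrite mulr_natl -sumr_const; apply: ler_sum => c _.
  exact: bernstein.
move=> w c nB; apply: ltW; rewrite ltNge; apply/negP => h.
by apply: nB; exists c.
Qed.

Variables (S : Type) (box : S -> Prop) (h : S -> T -> R).
Hypothesis mh : forall sigma, measurable_fun setT (h sigma).
Hypothesis h01 : forall sigma t, 0 <= h sigma t <= 1.

(** Approximation is exact off a rare event, rather than close in a metric: differences of
    approximations then have small support, as [bernstein] requires. *)
Definition is_cover (I : finType) (cell : S -> I) (rep : I -> S) (A : I -> set T)
    (p : R) : Prop :=
  [/\ forall c, box (rep c), forall c, measurable (A c),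
      forall c, fine (D (A c)) <= p &
      forall sigma t, box sigma -> ~ A (cell sigma) t ->
        h sigma t = h (rep (cell sigma)) t].

Variables (eta delta : R) (N : nat -> R).
Hypothesis eta_gt0 : 0 < eta.
Hypothesis delta_gt0 : 0 < delta.
Hypothesis cover : forall k, exists (I : finType) (cell : S -> I)
  (rep : I -> S) (A : I -> set T),
  #|I|%:R <= N k /\ is_cover cell rep A (16^-1 ^+ k).

(** The deviations [u k] sum to [eta / 4]. A link at level [k.+1] lives on an exceptional event of
    level [k], of probability at most [16^-1 ^+ k = p k.+1]. The ratio [u k ^+ 2 / p k] grows like
    [4 ^+ k]. *)
Let u (k : nat) : R := eta / 8 * 2^-1 ^+ k.
Let p (k : nat) : R := 16 * 16^-1 ^+ k.

(** The 4 counts two families, links and exceptional events, each with a two-sided bound; the shares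
    of [delta] sum to at most [delta]. *)
Hypothesis failure : forall k,
  4 * N k * expR (- (m%:R * u k ^+ 2 / (32 * p k))) <= delta * 2^-1 ^+ k.+1.

Let h1 sigma t : `|h sigma t| <= 1.
Proof. by have /andP[a b] := h01 sigma t; rewrite ger0_norm. Qed.

Let hB1 sigma sigma' t : `|h sigma t - h sigma' t| <= 1.
Proof.
have /andP[? ?] := h01 sigma t; have /andP[? ?] := h01 sigma' t.
by rewrite ler_norml; apply/andP; split; lra.
Qed.

Let mhB sigma sigma' : measurable_fun setT (fun t => h sigma t - h sigma' t).
Proof. exact: measurable_funB. Qed.

Lemma chaining_level (k : nat) (I : finType) (cell : S -> I) (rep : I -> S)
    (A : I -> set T) (F : I -> T -> R) : #|I|%:R <= N k ->
  is_cover cell rep A (16^-1 ^+ k) -> u k <= 4 * p k ->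
  (forall c, measurable_fun setT (F c)) -> (forall c t, `|F c t| <= 1) ->
  (forall c, fine (D [set t | F c t != 0]) <= p k) ->
  exists E : set Omega, [/\ measurable E,
    fine (Q (~` E)) <= delta * 2^-1 ^+ k.+1,
    forall w c, E w -> `|deviation (F c) w| <= m%:R * u k &
    forall w c, E w -> deviation \1_(A c) w <= m%:R * u k].
Proof.
move=> cardI [_ mA DA _] upk mF F1 Fp.
have p0 : 0 < p k by rewrite mulr_gt0// exprn_gt0// invr_gt0.
have u0 : 0 < u k by rewrite mulr_gt0 ?exprn_gt0 ?invr_gt0 ?divr_gt0.
have up : 0 < u k <= 4 * p k by rewrite u0.
have [E1 [mE1 QE1 E1P]] := finite_deviation_event mF F1 p0 Fp up.
have [|||E2 [mE2 QE2 E2P]] := finite_deviation_event (F := fun c => \1_(A c)) _ _ p0 _ up.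
- by move=> c; exact: measurable_indic.
- by move=> c t; exact: indic_norm_le1.
- move=> c; apply: le_trans (_ : _ <= fine (D (A c))) _.
    suff -> : [set t | \1_(A c) t != 0 :> R] = A c by [].
    apply/seteqP; split => t /=; rewrite indicE.
      by case: (boolP (t \in A c)) => [/set_mem//|_ /eqP].
    by move=> At; rewrite mem_set// oner_eq0.
  apply: le_trans (DA c) _; rewrite /p ler_peMl ?exprn_ge0 ?invr_ge0//.
  by rewrite ler1n.
exists (E1 `&` E2); split; first exact: measurableI.
- apply: le_trans (failure k).
  apply: le_trans (_ : _ <= fine (Q (~` E1)) + fine (Q (~` E2))) _.
    exact: fine_prob_setCI_le.
  have : #|I|%:R * (2 * expR (- (m%:R * u k ^+ 2 / (32 * p k)))) <=
      N k * (2 * expR (- (m%:R * u k ^+ 2 / (32 * p k)))).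
    by rewrite ler_wpM2r// mulr_ge0// expR_ge0.
  lra.
- by move=> w c [? _]; exact: E1P.
- by move=> w c [_ ?]; apply: le_trans (ler_norm _) _; exact: E2P.
Qed.

(** The deviation at a representative telescopes along the links, and the bounds [u j] add up. For
    the exceptional events only the bound of the last level is kept. *)
Lemma chaining (k : nat) : (forall j, (j <= k)%N -> u j <= 4 * p j) ->
  exists (I : finType) (cell : S -> I) (rep : I -> S) (A : I -> set T)
      (E : set Omega), is_cover cell rep A (16^-1 ^+ k) /\
    [/\ measurable E, fine (Q (~` E)) <= delta * (1 - 2^-1 ^+ k.+1),
      forall w c, E w -> `|deviation (h (rep c)) w| <=
        m%:R * (eta / 4 * (1 - 2^-1 ^+ k.+1)) &
      forall w c, E w -> deviation \1_(A c) w <= m%:R * u k].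
Proof.
elim: k => [|k IH] up.
  have [I [cell [rep [A [cardI coverI]]]]] := cover 0.
  have [|||E [mE QE E1 E2]] := chaining_level (F := fun c => h (rep c))
    cardI coverI (up 0%N (leqnn _)).
  - by move=> c; exact: mh.
  - by move=> c t; exact: h1.
  (* Level 0 has no coarser cover: the full [h (rep c)] is used, and [p 0 = 16] makes the support
     condition trivial. *)
  - move=> c; apply: le_trans (fine_prob_le1 _ _) _; last by rewrite /p expr0; lra.
    have -> : [set t | h (rep c) t != 0] = h (rep c) @^-1` (~` [set 0]).
      by apply/seteqP; split => t /= /eqP.
    by rewrite -[X in measurable X]setTI; apply: mh => //; exact: measurableC.
  exists I, cell, rep, A, E; split => //; split => //.
    by apply: le_trans QE _; rewrite ler_pM2l// expr1; lra.
  move=> w c Ew; apply: le_trans (E1 w c Ew) _; rewrite ler_wpM2l//.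
  by rewrite /u expr0 expr1; lra.
have [j jk|I [cell [rep [A [E [[boxr mA DA app] [mE QE E1 E2]]]]]]] := IH.
  by apply: up; exact: leqW.
have [I' [cell' [rep' [A' [cardI' coverI']]]]] := cover k.+1.
(* The parent of a fine representative: the coarse representative of its cell. The link between them
   vanishes off [A (cell (rep' c))]. *)
pose pi c := rep (cell (rep' c)).
have [boxr' mA' DA' app'] := coverI'.
have [|||E' [mE' QE' E1' E2']] := chaining_level
    (F := fun c t => h (rep' c) t - h (pi c) t) cardI' coverI' (up k.+1 (leqnn _)).
- by move=> c; exact: mhB.
- by move=> c t; exact: hB1.
- move=> c; apply: le_trans (_ : _ <= fine (D (A (cell (rep' c))))) _.
    apply: le_fine_prob => //.
      have -> : [set t | h (rep' c) t - h (pi c) t != 0] =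
          (fun t => h (rep' c) t - h (pi c) t) @^-1` (~` [set 0]).
        by apply/seteqP; split => t /= /eqP.
      by rewrite -[X in measurable X]setTI; apply: mhB => //; exact: measurableC.
    move=> t /= /eqP ht; apply: contrapT => nA; apply: ht.
    by rewrite (app _ _ (boxr' c) nA) subrr.
  by apply: le_trans (DA _) _; rewrite /p exprS mulrA divff// mul1r.
exists I', cell', rep', A', (E `&` E'); split => //; split => //.
- exact: measurableI.
- apply: le_trans (_ : _ <= fine (Q (~` E)) + fine (Q (~` E'))) _.
    exact: fine_prob_setCI_le.
  apply: le_trans (lerD QE QE') _.
  by rewrite -mulrDr ler_pM2l// [2^-1 ^+ k.+2]exprS; lra.
- move=> w c [Ew Ew'].
  have := E1' w c Ew'; rewrite deviationB// => d1.
  have d2 := E1 w (cell (rep' c)) Ew.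
  have -> : deviation (h (rep' c)) w = (deviation (h (rep' c)) w -
      deviation (h (pi c)) w) + deviation (h (pi c)) w by ring.
  apply: le_trans (ler_normD _ _) _; apply: le_trans (lerD d1 d2) _.
  rewrite -mulrDr ler_wpM2l// /u [2^-1 ^+ k.+2]exprS; lra.
- by move=> w c [_ ?]; exact: E2'.
Qed.

(** Chaining stops at the first scale whose exceptional events have probability at most [eta / 16].
    Stopping there keeps [u j <= 4 * p j], the range of Bernstein's bound, at every level used. *)
Lemma uniform_deviation : eta < 1 ->
  exists E : set Omega, [/\ measurable E, fine (Q (~` E)) <= delta &
    forall w sigma, E w -> box sigma ->
      `|deviation (h sigma) w| <= m%:R * (eta / 2)].
Proof.
move=> eta1.
have exK : exists K, 16 <= eta * 16 ^+ K.
  exists (Num.trunc (16 / eta)).+1; rewrite mulrC -ler_pdivrMr//.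
  apply: ltW; apply: lt_le_trans (truncnS_gt _) _.
  rewrite -natrX ler_nat; apply: ltnW; exact: ltn_expl.
(* The least scale is positive as [eta < 1]; minimality gives [eta * 16 ^+ K < 16], hence the bound
   256 one level up. *)
case: (ex_minnP exK) => -[|K] hK minK; first by move: hK; rewrite expr0; lra.
have hK' : eta * 16 ^+ K < 16.
  by rewrite ltNge; apply/negP => /minK; rewrite ltnn.
have i16 k : 16^-1 ^+ k = (16 ^+ k)^-1 :> R by rewrite exprVn.
have up j : (j <= K.+1)%N -> u j <= 4 * p j.
  move=> jK; rewrite /u /p i16.
  have x0 : 0 < 16 ^+ j :> R by rewrite exprn_gt0.
  rewrite mulrA ler_pdivlMr//.
  have jle : eta * 16 ^+ j <= 256.
    apply: le_trans (_ : _ <= eta * 16 ^+ K.+1) _.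
      by rewrite ler_pM2l// ler_eXn2l// ltr1n.
    by rewrite exprS; lra.
  have le1 : 2^-1 ^+ j <= 1 :> R by rewrite exprn_ile1// ?invr_ge0// invf_le1// ler1n.
  have ge0 : 0 <= 2^-1 ^+ j :> R by rewrite exprn_ge0// invr_ge0.
  have : eta * 16 ^+ j * (2^-1 ^+ j) <= 256 * 1.
    by apply: ler_pM => //; rewrite mulr_ge0 ?ltW.
  lra.
have [I [cell [rep [A [E [[boxr mA DA app] [mE QE E1 E2]]]]]]] := chaining up.
have half0 : 0 < 2^-1 ^+ K.+2 :> R by rewrite exprn_gt0// invr_gt0.
exists E; split => //.
  by apply: le_trans QE _; rewrite ler_piMr ?ltW//; lra.
move=> w sigma Ew bs; set c := cell sigma.
have := @deviation_le_indic (fun t => h sigma t - h (rep c) t) (A c) w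
  (mhB _ _) (mA c).
rewrite deviationB// => dA.
have dle := dA _ => {dA}.
have d1 := E1 w c Ew; have d2 := E2 w c Ew.
have -> : deviation (h sigma) w = (deviation (h sigma) w -
    deviation (h (rep c)) w) + deviation (h (rep c)) w by ring.
apply: le_trans (ler_normD _ _) _; apply: le_trans (lerD (dle _) d1) _.
  move=> t; rewrite indicE; case: (boolP (t \in A c)) => [_|/negP nA] /=.
    exact: hB1.
  by rewrite (app _ t bs) ?subrr ?normr0// => At; apply: nA; rewrite inE.
have DAc : fine (D (A c)) <= eta / 16.
  apply: le_trans (DA c) _; rewrite i16 -[leRHS]invrK.
  rewrite lef_pV2 ?posrE ?invr_gt0 ?divr_gt0 ?exprn_gt0//.
  by rewrite invf_div ler_pdivrMr// mulrC.
have mD : m%:R * fine (D (A c)) <= m%:R * (eta / 16) by rewrite ler_wpM2l.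
apply: le_trans (_ : _ <= m%:R * u K.+1 + 2 * (m%:R * (eta / 16)) +
   m%:R * (eta / 4 * (1 - 2^-1 ^+ K.+2))) _; first lra.
rewrite [2 * (_ * _)]mulrCA -!mulrDr ler_wpM2l// /u [2^-1 ^+ K.+2]exprS.
move: (2^-1 ^+ K.+1) => x.
(* [eta / 8] comes from the mass of the last exceptional event, counted twice, and [eta / 4] from
   the chain together with the last indicator. *)
rewrite (_ : _ + _ = 3 / 8 * eta); last by field.
by rewrite [leLHS]mulrC ler_pM2l//; lra.
Qed.

End Chaining.

(** * Numerical bounds and the sample complexity *)

Lemma expR_natN_le (R : realType) (y : nat) : expR (- y%:R) <= (2 ^ y)%:R^-1 :> R.
Proof.
rewrite expRN lef_pV2 ?posrE ?expR_gt0 ?ltr0n ?expn_gt0// natrX -[y%:R]mulr1.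
rewrite expRM_natl lerXn2r ?nnegrE ?expR_ge0//.
by have := expR_ge1Dx (1 : R); lra.
Qed.

(** The logarithm of the cover size is only linear in [k]: the left exponent is at most
    [6 * k.+1 * n ^ 2], and [k.+1 <= 4 ^ k]. *)
Lemma cover_size_exponent (n k : nat) : (0 < n)%N ->
  (4 * (2 * 4 ^ n * 16 ^ k) ^ n * 2 ^ k.+1 <= 2 ^ (6 * 4 ^ k * n ^ 2))%N.
Proof.
move=> n0; rewrite -[4%N]/(2 ^ 2)%N -[16%N]/(2 ^ 4)%N.
have -> : (2 ^ 2 * (2 * (2 ^ 2) ^ n * (2 ^ 4) ^ k) ^ n * 2 ^ k.+1 =
    2 ^ (2 + (1 + 2 * n + 4 * k) * n + k.+1))%N.
  by rewrite -!expnM -expnS -expnD -expnM -!expnD.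
rewrite leq_exp2l//.
have k4 : (k < (2 ^ 2) ^ k)%N by exact: ltn_expl.
apply: (@leq_trans (6 * k.+1 * n ^ 2)%N); last first.
  by rewrite leq_mul2r leq_mul2l k4 !orbT.
nia.
Qed.

(** The [n%:R ^+ 2] part of the exponent pays for the cover and for the factor [2^-1 ^+ k.+1]; of
    the [L] part a single copy is kept, since [4 ^+ k >= 1]. *)
Lemma chaining_failure_bound (R : realType) (n k : nat) (L : R) : (0 < n)%N ->
  0 <= L ->
  4 * ((2 * 4 ^ n * 16 ^ k) ^ n)%:R * expR (- (6 * 4 ^+ k * (n%:R ^+ 2 + L)))
  <= expR (- L) * 2^-1 ^+ k.+1.
Proof.
move=> n0 L0; set N := ((2 * 4 ^ n * 16 ^ k) ^ n)%N.
have pk : 1 <= 4 ^+ k :> R by rewrite exprn_ege1// ler1n.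
apply: le_trans (_ : _ <= 4 * N%:R *
    (expR (- (6 * 4 ^ k * n ^ 2)%:R) * expR (- L))) _.
  rewrite ler_wpM2l ?mulr_ge0// -expRD ler_expR !natrM !natrX.
  rewrite mulrDr opprD lerD2l lerN2 ler_peMl//; lra.
rewrite mulrA mulrC ler_pM2l ?expR_gt0//.
apply: le_trans (_ : _ <= 4 * N%:R * (2 ^ (6 * 4 ^ k * n ^ 2))%:R^-1) _.
  by rewrite ler_wpM2l ?mulr_ge0// expR_natN_le.
rewrite ler_pdivrMr ?ltr0n ?expn_gt0// exprVn -[leRHS]mulrC.
rewrite ler_pdivlMr ?exprn_gt0// -natrX -!natrM ler_nat.
exact: cover_size_exponent.
Qed.

Lemma exp_lossE (R : realType) (n : nat) (H : R) (d : measure_display)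
    (T : measurableType d) (D : probability T R) (g : T -> cmgame R n)
    (sigma : 'I_n -> R) : 1 <= H -> valid_games H g -> measurable_games g ->
  exp_loss D g sigma = (\int[D]_t avg_loss (g t) sigma)%:E.
Proof.
move=> H1 vg mg; rewrite /exp_loss /Rintegral fineK//.
have avg_le t : `|avg_loss (g t) sigma| <= 2 * n%:R * H.
  by have /andP[a0 aB] := avg_loss_itv sigma H1 (vg t); rewrite ger0_norm.
have := bounded_integrable D (measurable_avg_loss mg sigma) avg_le.
exact: integrable_fin_num.
Qed.

Theorem theorem11 :
  exists c : nat, forall (R : realType) (n : nat) (H eps delta : R),
    1 <= H -> 0 < eps -> 0 < delta ->
    forall (dT : measure_display) (T : measurableType dT)
           (D : probability T R) (g : T -> cmgame R n),
      valid_games H g -> measurable_games g ->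
    forall m : nat,
      c%:R * ((n%:R ^+ 2 * H ^+ 2) / eps ^+ 2) * (n%:R ^+ 2 + ln (delta^-1))
        <= m%:R ->
    forall (dO : measure_display) (Omega : measurableType dO)
           (Q : probability Omega R) (X : 'I_m -> Omega -> T),
      iid_sample Q D X ->
      exists E : set Omega,
        [/\ measurable E, ((1 - delta)%:E <= Q E)%E &
            forall w, E w ->
            forall sigma_hat, in_box H sigma_hat ->
              (forall sigma, in_box H sigma ->
                 emp_loss g X w sigma_hat <= emp_loss g X w sigma) ->
              forall sigma, in_box H sigma ->
                (exp_loss D g sigma_hat <= exp_loss D g sigma + eps%:E)%E].
Proof.
(* 6 comes from [cover_size_exponent], [2 ^ 15 = 32 * 16 * 8 ^ 2] from the exponent in [failure],
   and [2 ^ 2] from the range [2 * n%:R * H] of the loss, squared. *)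
exists (6 * 2 ^ 17)%N => R n H eps delta H1 eps0 delta0 dT T D g vg mg m.
rewrite natrM natrX => hm dO Omega Q X iidX.
have H0 : 0 <= H by lra.
have QT : ((1 - delta)%:E <= Q setT)%E by rewrite probability_setT lee_fin; lra.
(* Degenerate cases first: without agents there is one subsidy vector; [1 <= delta] admits the empty
   event; and if [B <= eps], no two losses differ by more than [eps]. *)
have [n0|n0] := posnP n.
  exists setT; split => // w _ s1 _ _ s2 _.
  have -> : s1 = s2.
    apply/funext => i; exfalso.
    by have := leq_ltn_trans (leq0n i) (ltn_ord i); rewrite n0.
  by rewrite leeDl// lee_fin ltW.
have [delta1|delta1] := leP 1 delta.
  exists set0; split => //.
  by rewrite measure0 lee_fin subr_le0.
have n1 : 0 < n%:R :> R by rewrite ltr0n.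
pose B : R := 2 * n%:R * H.
have B0 : 0 < B by rewrite !mulr_gt0//; lra.
have avg_itv t sigma := avg_loss_itv sigma H1 (vg t).
have avg_le t sigma : `|avg_loss (g t) sigma| <= B.
  by have /andP[a0 aB] := avg_itv t sigma; rewrite ger0_norm.
have mavg := measurable_avg_loss mg.
have iavg sigma : D.-integrable setT (EFin \o (fun t => avg_loss (g t) sigma)).
  exact: (bounded_integrable D (mavg sigma) (fun t => avg_le t sigma)).
have expE sigma := exp_lossE D sigma H1 vg mg.
have [epsB|epsB] := leP B eps.
  exists setT; split => // w _ s1 _ _ s2 _.
  rewrite !expE -EFinD lee_fin.
  apply: le_trans (_ : _ <= B) _.
    apply: le_trans (_ : _ <= \int[D]_t (cst B t)) _.
      apply: le_Rintegral => //.
        by apply: (@bounded_integrable _ _ _ _ (cst B) B) => // t; rewrite gtr0_norm.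
      by move=> t _; have /andP[] := avg_itv t s1.
    by rewrite Rintegral_cst// (congr1 fine (probability_setT D)) mulr1.
  apply: le_trans epsB _; rewrite lerDr.
  by apply: Rintegral_ge0 => t _; have /andP[] := avg_itv t s2.
pose eta := eps / B; pose L := ln delta^-1.
have eta0 : 0 < eta by rewrite divr_gt0.
have eta1 : eta < 1 by rewrite ltr_pdivrMr// mul1r.
have L0 : 0 <= L by rewrite ln_ge0// invf_ge1// ltW.
have expL : expR (- L) = delta by rewrite expRN lnK ?invrK// posrE invr_gt0.
have meta : 6 * 2 ^+ 15 * (n%:R ^+ 2 + L) <= m%:R * eta ^+ 2.
  rewrite -ler_pdivrMr ?exprn_gt0//; apply: le_trans hm.
  rewrite le_eqVlt; apply/orP; left; apply/eqP.
  rewrite /eta /B -/L; field.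
  by rewrite !lt0r_neq0//; lra.
have m0 : 0 < m%:R :> R.
  have : 0 < m%:R * eta ^+ 2.
    apply: lt_le_trans meta; rewrite mulr_gt0 ?mulr_gt0 ?exprn_gt0//.
    by rewrite ltr_wpDr ?exprn_gt0.
  by rewrite pmulr_lgt0 ?exprn_gt0.
pose h (sigma : 'I_n -> R) t := avg_loss (g t) sigma / B.
have mh sigma : measurable_fun setT (h sigma) by exact: measurable_funM.
have h01 sigma t : 0 <= h sigma t <= 1.
  have /andP[a0 aB] := avg_itv t sigma.
  by rewrite /h divr_ge0 ?(ltW B0)//= ler_pdivrMr// mul1r.
pose N k : R := ((2 * 4 ^ n * 16 ^ k) ^ n)%:R.
have cover k : exists (I : finType) (cell : ('I_n -> R) -> I)
    (rep : I -> 'I_n -> R) (A : I -> set T),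
    #|I|%:R <= N k /\ is_cover D (in_box H) h cell rep A (16^-1 ^+ k).
  have P0 : (0 < 16 ^ k)%N by rewrite expn_gt0.
  have [I [cell [rep [A [cardI boxr mA DA app]]]]] := game_cover D n0 P0 H0 mg.
  exists I, cell, rep, A; split; first by rewrite ler_nat.
  split => // [c|sigma t bs nA].
    by rewrite exprVn -natrX.
  by rewrite /h (app _ _ bs nA).
have failure k : 4 * N k * expR (- (m%:R * (eta / 8 * 2^-1 ^+ k) ^+ 2 /
    (32 * (16 * 16^-1 ^+ k)))) <= delta * 2^-1 ^+ k.+1.
  rewrite -expL; apply: le_trans (chaining_failure_bound k n0 L0).
  rewrite ler_wpM2l ?mulr_ge0// ler_expR lerN2.
  have -> : m%:R * (eta / 8 * 2^-1 ^+ k) ^+ 2 / (32 * (16 * 16^-1 ^+ k)) =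
      4 ^+ k * (m%:R * eta ^+ 2 / 2 ^+ 15).
    have -> : 16^-1 ^+ k = (4 ^+ k)^-1 * (2^-1 ^+ k) ^+ 2 :> R.
      by rewrite -exprVn -exprM mulnC exprM -exprMn; congr (_ ^+ _); field.
    field.
    by rewrite !expf_neq0.
  rewrite mulrAC mulrC ler_wpM2l ?exprn_ge0// ler_pdivlMr ?exprn_gt0//.
  by apply: le_trans meta; rewrite le_eqVlt; apply/orP; left; apply/eqP; ring.
have [E [mE QE EP]] := uniform_deviation iidX mh h01 eta0 delta0 cover failure eta1.
exists E; split => //.
  rewrite -[Q E]fineK ?fin_num_measure// lee_fin.
  by move: QE; rewrite fine_prob_setC//; lra.
have close w sigma : E w -> in_box H sigma ->
    `|emp_loss g X w sigma - \int[D]_t avg_loss (g t) sigma| <= eps / 2.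
  move=> Ew bs; have := EP w sigma Ew bs.
  (* Undoing the normalisation by [B]: the bound [eta / 2] becomes [eps / 2] for the original
     losses. *)
  have -> : deviation D X (h sigma) w = m%:R / B *
      (emp_loss g X w sigma - \int[D]_t avg_loss (g t) sigma).
    rewrite /deviation /h RintegralZr// -mulr_suml /emp_loss; field.
    by rewrite !lt0r_neq0.
  rewrite normrM (ger0_norm (divr_ge0 (ltW m0) (ltW B0))) /eta => hd.
  rewrite -(@ler_pM2l _ (m%:R / B)) ?divr_gt0//; apply: le_trans hd _.
  by rewrite le_eqVlt; apply/orP; left; apply/eqP; field; rewrite lt0r_neq0.
(* Empirical risk minimisation: [eps / 2] is lost passing from mean to sample at [s1], and again
   from sample to mean at [s2]. *)
move=> w Ew s1 b1 opt s2 b2; rewrite !expE -EFinD lee_fin.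
have := close w s1 Ew b1; have := close w s2 Ew b2; have := opt s2 b2.
by rewrite !ler_norml => ? /andP[? ?] /andP[? ?]; lra.
Qed.
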